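(* Let $n\ge 0$ be an even integer. Then $$\sum _{m=1}^{\left\lfloor \sqrt{n}\right\rfloor } (-1)^{m-1}p(n-m^2) = \sum _{m=1}^{\left\lfloor \sqrt{n/2}\right\rfloor } (-1)^{m-1}p(n-2m^2) = \frac{p(n) - p_{\mathcal{DO}}(n)}{2}.$$
   Context: $p(n)$ denotes the number of partitions of $n$ (Euler's partition function, $p(0)=1$), and $p_{\mathcal{DO}}(n)$ denotes the number of partitions of $n$ into distinct odd parts ($p_{\mathcal{DO}}(0)=1$). Empty sums are $0$. *)

(* Defs.v *)
From mathcomp Require Import all_boot all_order all_algebra.

Set Implicit Arguments.
Unset Strict Implicit.
Unset Printing Implicit Defensive.

Definition is_partition (n : nat) (s : seq nat) : bool :=
  [&& sorted geq s, 0 \notin s & sumn s == n].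

(* A partition of n has at most n parts, each at most n, so restricting to the
   finite type of sequences of length <= n over 'I_n.+1 loses nothing: this is
   [is_partition_bounded] below. *)
Definition pn (n : nat) : nat :=
  #|[set s : n.-bseq 'I_n.+1 | is_partition n (map val s)]|.

Definition pn_distinct_odd (n : nat) : nat :=
  #|[set s : n.-bseq 'I_n.+1 | [&& is_partition n (map val s),
      uniq (map val s) & all odd (map val s)]]|.

Lemma is_partition_bounded (n : nat) (s : seq nat) :
  is_partition n s -> exists t : n.-bseq 'I_n.+1, map val t = s.
Proof.
case/and3P=> _ s0 /eqP sn.
have sz : size s <= n.
  rewrite -{}sn; elim: s s0 => //= x s IHs; rewrite inE negb_or eq_sym -lt0n.
  by case/andP=> x0 /IHs; rewrite -add1n; apply: leq_add.
have le_n x : x \in s -> x < n.+1.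
  rewrite ltnS -{}sn {s0 sz}; elim: s => //= y s IHs; rewrite inE.
  case/orP=> [/eqP-> | /IHs xs]; first exact: leq_addr.
  exact: leq_trans xs (leq_addl _ _).
have ts : map val (map (@inord n) s) = s.
  rewrite -map_comp -[RHS]map_id; apply/eq_in_map => x xs /=.
  by rewrite inordK ?le_n.
have szt : size (map (@inord n) s) <= n by rewrite size_map.
by exists (Bseq szt).
Qed.

(* Main.v *)
Require Import Defs.
From mathcomp Require Import all_boot all_order all_algebra.
From mathcomp Require Import ring lra zify.

(** Both identities are coefficient extractions from products with Gauss's
    theta series. Write (a; q) for the infinite product of the 1 - a q^k,
    k >= 0, and theta(q) for the sum of (-1)^m q^(m^2) over all integers m.
    Gauss's identity says
      theta(q) = (q; q^2)^2 (q^2; q^2).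
    The generating function of the partitions is 1 / (q; q), and
    (q; q) = (q; q^2) (q^2; q^2), hence
      theta(q) / (q; q) = (q; q^2).
    Since (q^2; q^4) = (q; q^2) (-q; q^2), Gauss's identity at q^2 gives
      theta(q^2) / (q; q) = (-q; q^2).
    The last product is the generating function of the partitions into distinct
    odd parts, and (q; q^2) is obtained from it by q |-> -q. The coefficients of
    q^n are thus, for every n,
      p(n) + 2 sum_(m >= 1) (-1)^m p(n - m^2) = (-1)^n p_DO(n),
      p(n) + 2 sum_(m >= 1) (-1)^m p(n - 2 m^2) = p_DO(n)
    ([partition_square_recurrence], [partition_double_square_recurrence]), and
    the two right-hand sides agree when n is even.

    Power series are replaced by polynomials modulo a power of the variable.
    Gauss's identity then becomes a congruence ([theta_oddpoch]), which follows
    from an exact polynomial identity ([finite_gauss]): the q-binomial theorem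
    in base q^2 for 2n factors, at the point that makes the exponents symmetric
    around the middle term. Its coefficients, once multiplied by
    (1 - q^2) ... (1 - q^(2n)), are 1 up to high powers of q ([qbin_stable]). *)

Set Implicit Arguments.
Unset Strict Implicit.
Unset Printing Implicit Defensive.

Import GRing.Theory.
Local Open Scope ring_scope.

(** * Gaussian binomials and a finite Gauss identity *)

Section QBinomial.
Variable R : comNzRingType.
Implicit Types q x y : R.

(** Gaussian binomial coefficients, given by the q-Pascal rule so that they make
    sense for every q, including roots of unity. *)
Fixpoint qbin q m j : R :=
  match m, j with
  | _, 0 => 1
  | 0, _.+1 => 0
  | m'.+1, j'.+1 => qbin q m' j' + q ^+ j'.+1 * qbin q m' j'.+1
  end.

(** The finite forms of the infinite products (q; q) and (q; q^2). *)
Definition qpoch q n : R := \prod_(i < n) (1 - q ^+ i.+1).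
Definition oddpoch q n : R := \prod_(i < n) (1 - q ^+ i.*2.+1).

Lemma qbin0 q m : qbin q m 0 = 1. Proof. by case: m. Qed.

Lemma qbinS q m j :
  qbin q m.+1 j.+1 = qbin q m j + q ^+ j.+1 * qbin q m j.+1.
Proof. by []. Qed.

Lemma qbin_small q m j : (m < j)%N -> qbin q m j = 0.
Proof.
elim: m j => [|m IHm] [|j] // lt_mj.
have lt_mSj: (m < j.+1)%N by apply: leqW.
by rewrite qbinS (IHm j lt_mj) (IHm j.+1 lt_mSj) mulr0 addr0.
Qed.

(** The product formula for Gaussian binomials, free of denominators. In the
    q-Pascal rule for a + b + 2 over a + 1, the two terms contribute
    1 - q^(a+1) and q^(a+1) (1 - q^(b+1)) times the same product, and these
    factors add up to 1 - q^(a+b+2). *)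
Lemma qbin_qpoch q a b :
  qbin q (a + b) a * (qpoch q a * qpoch q b) = qpoch q (a + b).
Proof.
have [n le_n] := ubnP (a + b).
elim: n => // n IHn in a b le_n *.
case: a b => [|a] [|b] in le_n *.
- by rewrite /qpoch !big_ord0 !mulr1.
- by rewrite qbin0 [qpoch q 0]big_ord0 !mul1r.
- rewrite addn0 [qpoch q 0]big_ord0 mulr1 qbinS (qbin_small q (ltnSn a)) mulr0.
  have:= IHn a 0%N; rewrite addn0 [qpoch q 0]big_ord0 mulr1 => IH.
  by rewrite addr0 /qpoch !big_ord_recr /= mulrA IH //; lia.
have IHl: qbin q (a + b.+1) a * (qpoch q a * qpoch q b.+1) = qpoch q (a + b.+1).
  by apply: IHn; lia.
have IHr: qbin q (a + b.+1) a.+1 * (qpoch q a.+1 * qpoch q b) =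
          qpoch q (a + b.+1).
  by rewrite addnS -addSn; apply: IHn; lia.
have pS k : qpoch q k.+1 = qpoch q k * (1 - q ^+ k.+1).
  exact: big_ord_recr.
rewrite addSn qbinS [RHS]pS mulrDl {1}[qpoch q a.+1]pS {2}[qpoch q b.+1]pS.
rewrite [X in X + _ = _](_ : _ = qpoch q (a + b.+1) * (1 - q ^+ a.+1)); last first.
  by rewrite -IHl; ring.
rewrite [X in _ + X = _](_ : _ =
  qpoch q (a + b.+1) * (q ^+ a.+1 * (1 - q ^+ b.+1))); last by rewrite -IHr; ring.
by rewrite -addSn exprD; ring.
Qed.

(** Splitting off the factor y + x leaves the same product at x q, and the
    extra powers q^j are the ones that the q-Pascal rule needs. *)
Lemma qbinomial_theorem q x y m :
  \prod_(i < m) (y + x * q ^+ i) =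
  \sum_(j < m.+1) q ^+ 'C(j, 2) * qbin q m j * x ^+ j * y ^+ (m - j).
Proof.
elim: m x => [|m IHm] x.
  by rewrite big_ord0 big_ord1 qbin0 !mulr1.
rewrite big_ord_recl mulr1.
under eq_bigr => i _ do rewrite lift0 exprS mulrA.
rewrite IHm mulrDl !mulr_sumr big_ord_recl [RHS]big_ord_recl !qbin0 !subn0.
rewrite -addrA; congr (_ + _); first by rewrite /= exprS; ring.
under [RHS]eq_bigr => i _.
  rewrite lift0 qbinS mulrDr !mulrDl subSS; over.
rewrite big_split /= addrC; congr (_ + _).
  apply: eq_bigr => i _; rewrite binS bin1 exprD exprMn exprS; ring.
rewrite [RHS]big_ord_recr /= qbin_small // !(mulr0, mul0r) addr0.
apply: eq_bigr => i _; rewrite /bump leq0n add1n.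
rewrite (_ : m - i = (m - i.+1).+1)%N; last first.
  by have:= ltn_ord i; lia.
by rewrite exprMn !(exprS x, exprS y); move: (y ^+ _) => z; ring.
Qed.

Lemma qpoch_double q n :
  qpoch q n.*2 = oddpoch q n * qpoch (q ^+ 2) n.
Proof.
elim: n => [|n IHn]; first by rewrite /qpoch /oddpoch !big_ord0 mulr1.
rewrite doubleS /qpoch /oddpoch !big_ord_recr /= -/(qpoch _ _) IHn.
rewrite /oddpoch /qpoch -exprM mul2n doubleS; ring.
Qed.

(** Factor 1 - q^(2(2i+1)) as a difference of squares; the exponent 2i + 1 being
    odd, the factors 1 + q^(2i+1) are those of the product at - q. *)
Lemma oddpoch_sqr q n :
  oddpoch (q ^+ 2) n = oddpoch q n * oddpoch (- q) n.
Proof.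
rewrite /oddpoch -big_split /=; apply: eq_bigr => i _.
rewrite exprNn -signr_odd /= odd_double expr1 -exprM mulnC exprM; ring.
Qed.

Lemma sum_centered (f : nat -> R) n :
  \sum_(j < n.*2.+1) f j =
  f n + \sum_(1 <= m < n.+1) (f (n + m)%N + f (n - m)%N).
Proof.
rewrite -(big_mkord xpredT f) (@big_cat_nat _ _ _ n) //=; last by lia.
rewrite [X in _ + X]big_ltn; last by lia.
rewrite addrCA; congr (_ + _); rewrite big_split /= addrC; congr (_ + _).
  rewrite -{1}[n.+1]add1n big_addn (_ : (_ - n)%N = n.+1); last by lia.
  by apply: eq_bigr => i _; rewrite addnC.
rewrite big_nat_rev /= big_add1 /=; apply: eq_bigr => i _.
by congr (f _); lia.
Qed.
End QBinomial.

(** A finite form of Gauss's identity. In the q-binomial theorem take 2n factors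
    in base q^2, x = -1 and y = q^(2n-1). Each half of the product then gives the
    odd factors 1 - q^(2k+1) up to a monomial, while the exponent of the j-th
    term of the sum is, with j = n + m or j = n - m, a constant plus m^2. The
    common monomial (-1)^n q^e cancels. *)
Lemma finite_gauss (R : idomainType) (q : R) n : q != 0 ->
  oddpoch q n ^+ 2 =
  qbin (q ^+ 2) n.*2 n + \sum_(1 <= m < n.+1) (-1) ^+ m * q ^+ (m ^ 2) *
    (qbin (q ^+ 2) n.*2 (n + m) + qbin (q ^+ 2) n.*2 (n - m)).
Proof.
move=> q_neq0.
(* For n = 0 the truncated difference 2n - 1 is wrong, so that case is apart. *)
case: n => [|n]; first by rewrite /oddpoch !big_ord0 big_geq // addr0 expr1n.
set N := n.+1.
pose e := (N * (N - 1) + N * (N.*2 - 1))%N.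
have nz: (-1) ^+ N * q ^+ e != 0 by rewrite mulf_neq0 ?signr_eq0 ?expf_neq0.
apply: (mulfI nz).
transitivity (\prod_(i < N.*2) (q ^+ (N.*2 - 1) + (-1) * (q ^+ 2) ^+ i)).
  rewrite -addnn big_split_ord /= addnn.
  (* The lower half has factors q^(2i) (q^(2(n-1-i)+1) - 1); the reversal of i
     below lists them in increasing order. *)
  have -> : \prod_(i < N) (q ^+ (N.*2 - 1) + -1 * (q ^+ 2) ^+ i) =
            (-1) ^+ N * q ^+ (N * (N - 1)) * oddpoch q N.
    have -> : (-1) ^+ N * q ^+ (N * (N - 1)) = \prod_(i < N) - (q ^+ 2) ^+ i.
      elim: (N) => [|k IHk]; first by rewrite big_ord0 mulr1.
      rewrite big_ord_recr /= -IHk exprS -exprM.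
      have -> : (k.+1 * (k.+1 - 1) = k * (k - 1) + 2 * k)%N by case: (k) => [|l]; nia.
      by rewrite exprD; ring.
    rewrite /oddpoch (reindex_inj rev_ord_inj) [X in X * _](reindex_inj rev_ord_inj).
    rewrite -big_split /=; apply: eq_bigr => i _.
    have -> : (N.*2 - 1 = 2 * (N - i.+1) + i.*2.+1)%N by have:= ltn_ord i; lia.
    by rewrite exprD !exprM; ring.
  have -> : \prod_(i < N) (q ^+ (N.*2 - 1) + -1 * (q ^+ 2) ^+ (N + i)) =
            q ^+ (N * (N.*2 - 1)) * oddpoch q N.
    have <- : \prod_(i < N) q ^+ (N.*2 - 1) = q ^+ (N * (N.*2 - 1)).
      by rewrite prodr_const card_ord -exprM mulnC.
    rewrite /oddpoch -big_split /=.
    apply: eq_bigr => i _.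
    have -> : ((q ^+ 2) ^+ (N + i) = q ^+ (N.*2 - 1) * q ^+ i.*2.+1).
      by rewrite -exprM -exprD; congr (_ ^+ _); lia.
    ring.
  by rewrite /e exprD; ring.
rewrite qbinomial_theorem (sum_centered (fun j => (q ^+ 2) ^+ 'C(j, 2) *
   qbin (q ^+ 2) N.*2 j * (-1) ^+ j * (q ^+ (N.*2 - 1)) ^+ (N.*2 - j))).
have expo j m : (j = N + m \/ m + j = N)%N -> (j <= N.*2)%N ->
   (2 * 'C(j, 2) + (N.*2 - 1) * (N.*2 - j) = e + m ^ 2)%N.
  move=> jm le_j; have := mul_bin_left j 1; rewrite bin1 subn1 => ->.
  (* Naming the truncated difference 2N - j turns the claim into a polynomial
     identity, linear once the products of the constraints are supplied. *)
  rewrite /e -mulnn; have [l lP] : exists l, (l + j = N.*2)%N.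
    by exists (N.*2 - j)%N; lia.
  have -> : (N.*2 - j = l)%N by lia.
  have -> : (N.*2 - 1 = n.*2.+1)%N by lia.
  have -> : (N - 1 = n)%N by lia.
  have jj : (j.-1 * j + j = j * j)%N by case: (j) => //= k; rewrite mulSn addnC.
  case: jm => jm.
    have := congr1 (muln n) lP; rewrite {}jm /N in jj lP *; lia.
  have := congr1 (muln n) jm; have := congr1 (muln j) jm.
  have := congr1 (muln m) jm; have := congr1 (muln n) lP.
  rewrite /N; lia.
have term j m : (j = N + m \/ m + j = N)%N -> (j <= N.*2)%N ->
    (q ^+ 2) ^+ 'C(j, 2) * qbin (q ^+ 2) N.*2 j * (-1) ^+ j *
      (q ^+ (N.*2 - 1)) ^+ (N.*2 - j) =
    (-1) ^+ N * q ^+ e * ((-1) ^+ m * q ^+ (m ^ 2) * qbin (q ^+ 2) N.*2 j).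
  move=> jm le_j; rewrite -!exprM.
  have -> : (-1) ^+ j = (-1) ^+ N * (-1) ^+ m :> R.
    rewrite -exprD -signr_odd -[RHS]signr_odd; congr (_ ^+ _); lia.
  transitivity ((-1) ^+ N * (-1) ^+ m * qbin (q ^+ 2) N.*2 j *
    (q ^+ (2 * 'C(j, 2)) * q ^+ ((N.*2 - 1) * (N.*2 - j)))); first by ring.
  by rewrite -[q ^+ _ * q ^+ _]exprD (expo _ _ jm le_j) exprD; ring.
rewrite (term N 0%N) ?expr0 ?mul1r; [|lia..].
rewrite [RHS]mulrDr mulr_sumr; congr (_ + _).
apply: eq_big_nat => m /andP[_ lt_m].
by rewrite (term (N + m)%N m) ?(term (N - m)%N m) -?mulrDr //; lia.
Qed.

(** * Partitions and their generating functions *)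

(** Bounding the number of repetitions of a part, rather than fixing the sum of
    the parts, keeps the enumeration finite and makes its generating function a
    plain product. For decreasing [ds], b = 2 yields the partitions into distinct
    parts from [ds], and b > n is no restriction on the partitions of n. *)
Fixpoint blocks b (ds : seq nat) : seq (seq nat) :=
  if ds is d :: ds' then [seq nseq j d ++ s | j <- iota 0 b, s <- blocks b ds']
  else [:: [::]].

Lemma blocks_gf (R : comNzRingType) b ds :
  \sum_(s <- blocks b ds) 'X^(sumn s) =
  \prod_(d <- ds) \sum_(j < b) 'X^d ^+ j :> {poly R}.
Proof.
elim: ds => [|d ds IHds] /=; first by rewrite big_nil big_seq1.
rewrite big_cons -IHds big_allpairs_dep /= -{1}[b]subn0 -/(index_iota 0 b).
rewrite big_mkord big_distrl /=; apply: eq_bigr => j _.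
rewrite big_distrr /=; apply: eq_bigr => s _.
by rewrite sumn_cat sumn_nseq exprD exprM.
Qed.

(** A decreasing list splits in a unique way into the block of its copies of the
    largest allowed part and a list with smaller parts. *)
Lemma mem_blocks b ds s : (0 < b)%N -> sorted gtn ds ->
  s \in blocks b ds =
  [&& sorted geq s, all (mem ds) s & all (fun d => count_mem d s < b)%N ds].
Proof.
move=> b_gt0; elim: ds s => [|d ds IHds] s /=.
  by move=> _; rewrite inE; case: s => // x s; rewrite andbF.
rewrite (path_sortedE (rev_trans ltn_trans)) => /andP[/allP/= d_max ds_sorted].
have dNds: d \notin ds by apply/negP=> /d_max; rewrite ltnn.
have geq_tr : transitive geq by exact: (rev_trans leq_trans).
have geq_asym : antisymmetric geq by move=> x y /=; lia.
have nseq_sort j t : sorted geq t -> {subset t <= ds} ->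
    sorted geq (nseq j d ++ t).
  move=> t_sort t_ds; rewrite sorted_pairwise // pairwise_cat.
  rewrite -!sorted_pairwise // t_sort andbT; apply/andP; split.
    by apply/allrelP=> x y /nseqP[-> _] /t_ds /d_max /ltnW.
  by case: j => //= j; elim: j => //= j ->; rewrite leqnn.
apply/allpairsP/idP => [[[j t] /= [j_lt t_in ->]]|].
  move: t_in j_lt; rewrite IHds // mem_iota add0n /=.
  move=> /and3P[t_sort /allP t_ds t_cnt] j_lt.
  have dNt: d \notin t by apply: contra dNds => /t_ds.
  apply/and3P; split.
  - exact: nseq_sort.
  - apply/allP=> x; rewrite mem_cat => /orP[/nseqP[-> _]|/t_ds /= xds] /=.
      exact: mem_head.
    by rewrite inE xds orbT.
  - rewrite count_cat count_nseq /= eqxx mul1n (count_memPn dNt) addn0 j_lt /=.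
    apply/allP=> x x_ds; rewrite count_cat count_nseq /=.
    have /negPf-> : d != x by apply: contraNneq dNds => ->.
    by rewrite mul0n add0n (allP t_cnt).
case/and3P=> s_sort /allP s_ds /andP[d_cnt ds_cnt].
exists (count_mem d s, filter (predC1 d) s); split => /=.
- by rewrite mem_iota.
- rewrite IHds //; apply/and3P; split.
  + exact: sorted_filter.
  + apply/allP=> x; rewrite mem_filter /= => /andP[xd /s_ds].
    by case/predU1P=> // xd'; rewrite xd' eqxx in xd.
  apply/allP=> x x_ds; apply: leq_ltn_trans (allP ds_cnt _ x_ds).
  by rewrite count_filter; apply: sub_count => y /= /andP[].
apply: (sorted_eq geq_tr geq_asym) => //.
  apply: nseq_sort; first exact: sorted_filter.
  by move=> x; rewrite mem_filter => /andP[/= xd /s_ds] /=; rewrite inE (negPf xd).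
have /all_pred1P := filter_all (pred1 d) s; rewrite size_filter => <-.
by rewrite perm_sym perm_filterC.
Qed.

Lemma uniq_blocks b ds : sorted gtn ds -> uniq (blocks b ds).
Proof.
have [->|b_gt0] := posnP b; first by case: ds.
elim: ds => //= d ds IHds.
rewrite (path_sortedE (rev_trans ltn_trans)) => /andP[/allP/= d_max ds_sorted].
apply: allpairs_uniq; [exact: iota_uniq | exact: IHds |].
have dN t : t \in blocks b ds -> d \notin t.
  rewrite mem_blocks // => /and3P[_ /allP t_ds _].
  by apply/negP=> /t_ds /d_max; rewrite /= ltnn.
move=> [i s] [j t] /= /allpairsPdep[i' [s' [_ s_in [-> ->]]]].
case/allpairsPdep=> [j' [t' [_ t_in [-> ->]]]] eq_st.
have eq_ij: i' = j'.
  have:= congr1 (count_mem d) eq_st.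
  by rewrite !count_cat !count_nseq /= eqxx !mul1n !(count_memPn (dN _ _)) ?addn0.
rewrite eq_ij in eq_st *; congr (_, _).
by have:= congr1 (drop j') eq_st; rewrite !drop_size_cat ?size_nseq.
Qed.

(** Replaces bounded sequences of ordinals by plain lists of numbers: only an
    enumeration of the partitions is needed to count them. *)
Lemma card_partitions n (P : pred (seq nat)) (l : seq (seq nat)) :
  uniq l -> (forall s, P s -> is_partition n s) -> l =i P ->
  #|[set s : n.-bseq 'I_n.+1 | P (map val s)]| = size l.
Proof.
move=> l_uniq P_part lP.
pose f (s : n.-bseq 'I_n.+1) : seq nat := map val s.
have f_inj: injective f.
  by move=> s t /(inj_map val_inj) /val_inj.
rewrite cardE -(size_map f); apply/perm_size/uniq_perm => //.
  by rewrite map_inj_uniq ?enum_uniq.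
move=> s; rewrite lP; apply/mapP/idP => [[t]|Ps].
  by rewrite mem_enum inE => Pt ->.
have [t def_s] := is_partition_bounded (P_part s Ps).
by exists t => //; rewrite mem_enum inE def_s.
Qed.

Lemma coef_blocks (R : comNzRingType) b ds n :
  (\prod_(d <- ds) \sum_(j < b) 'X^d ^+ j : {poly R})`_n =
  (size [seq s <- blocks b ds | sumn s == n])%:R.
Proof.
rewrite -blocks_gf coef_sum size_filter -sum1_count natr_sum [RHS]big_mkcond /=.
by apply: eq_bigr => s _; rewrite coefXn eq_sym; case: eqP.
Qed.

Lemma mem_leq_sumn (x : nat) s : x \in s -> (x <= sumn s)%N.
Proof.
elim: s => //= y s IHs; rewrite inE => /predU1P[->|/IHs]; lia.
Qed.

Lemma count_leq_sumn (x : nat) s : (0 < x)%N -> (count_mem x s <= sumn s)%N.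
Proof.
by move=> x_gt0; elim: s => //= y s IHs; apply: leq_add => //; case: eqP => // ->.
Qed.

(** The factor at i is the geometric series of X^(i+1), cut off at m + 1 terms. *)
Lemma pn_coef (R : comNzRingType) m n : (n <= m)%N ->
  (\prod_(i < m) \sum_(j < m.+1) 'X^(i.+1) ^+ j : {poly R})`_n = (pn n)%:R.
Proof.
move=> le_nm.
have -> : \prod_(i < m) \sum_(j < m.+1) 'X^(i.+1) ^+ j =
    \prod_(d <- rev (iota 1 m)) \sum_(j < m.+1) 'X^d ^+ j :> {poly R}.
  rewrite (perm_big _ (introT permPl (perm_rev _))) /=.
  by rewrite -[m in iota 1 m]subn0 -subSS -/(index_iota 1 m.+1) big_add1 big_mkord.
rewrite coef_blocks; congr (_%:R).
have ds_sort: sorted gtn (rev (iota 1 m)) by rewrite rev_sorted iota_ltn_sorted.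
apply/esym/card_partitions => [|//|s].
  exact/filter_uniq/uniq_blocks.
rewrite mem_filter mem_blocks // -topredE /= /is_partition.
have [sum_s|_] := eqVneq (sumn s) n; last by rewrite !andbF.
rewrite andbT /=; congr (_ && _); apply/andP/idP => [[/allP s_ds _]|s0].
  by apply/negP=> /s_ds; rewrite /= mem_rev mem_iota.
split; apply/allP=> x.
  move=> xs; rewrite /= mem_rev mem_iota lt0n add1n ltnS.
  rewrite (leq_trans (mem_leq_sumn xs)) ?sum_s // andbT.
  by apply: contraNneq s0 => <-.
rewrite mem_rev mem_iota => /andP[x_gt0 _] /=.
by rewrite ltnS (leq_trans (count_leq_sumn _ x_gt0)) ?sum_s.
Qed.

Lemma pn_distinct_odd_coef (R : comNzRingType) m n : (n <= m.*2)%N ->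
  (\prod_(i < m) (1 + 'X^(i.*2.+1)) : {poly R})`_n = (pn_distinct_odd n)%:R.
Proof.
move=> le_nm; pose ds := rev [seq i.*2.+1 | i <- iota 0 m].
have ds_sort: sorted gtn ds.
  rewrite rev_sorted sorted_map; apply: sub_sorted (iota_ltn_sorted 0 m).
  by move=> i j /=; rewrite !ltnS ltn_double.
have ->: \prod_(i < m) (1 + 'X^(i.*2.+1)) =
    \prod_(d <- ds) \sum_(j < 2) 'X^d ^+ j :> {poly R}.
  rewrite /ds -map_rev big_map (perm_big _ (introT permPl (perm_rev _))) /=.
  rewrite -[X in iota 0 X]subn0 -/(index_iota 0 m) big_mkord; apply: eq_bigr => i _.
  by rewrite big_ord_recl big_ord1 expr0.
rewrite coef_blocks; congr (_%:R).
pose P s := [&& is_partition n s, uniq s & all odd s].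
apply/esym/(@card_partitions n P) => [|s /andP[] //|s].
  exact/filter_uniq/uniq_blocks.
rewrite mem_filter mem_blocks // -topredE /= /P /is_partition.
have [sum_s|_] := eqVneq (sumn s) n; last by rewrite !andbF.
rewrite andbT /= -!andbA; congr (_ && _).
have mem_ds x : (x \in ds) = odd x && (x < m.*2)%N.
  rewrite mem_rev; apply/mapP/andP=> [[i]|[x_odd lt_x]].
    by rewrite mem_iota => lt_i ->; rewrite /= odd_double; split=> //; lia.
  by exists x./2; rewrite ?mem_iota; lia.
apply/andP/and3P=> [[/allP s_ds /allP cnt]|[s0 s_uniq /allP s_odd]].
  split.
  - by apply/negP=> /s_ds; rewrite /= mem_ds.
  - apply/count_mem_uniq=> x; have [xs|xs] := boolP (x \in s); last exact/count_memPn.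
    have /= := cnt _ (s_ds _ xs); move: xs; rewrite -has_pred1 has_count.
    by case: (count_mem x s) => [|[]].
  - by apply/allP=> x /s_ds; rewrite /= mem_ds => /andP[].
split; apply/allP=> x; last by rewrite /= count_uniq_mem // => _; case: (_ \in _).
move=> xs; rewrite /= mem_ds (s_odd x xs) /=.
have:= mem_leq_sumn xs; have:= s_odd x xs; lia.
Qed.

(** * Congruences between polynomials *)

Section Congruences.
Variable F : fieldType.
Implicit Types c d p q r : {poly F}.

Lemma eqmodpP d p r : reflect (p %% d = r %% d) (d %| p - r).
Proof.
apply: (iffP (modp_eq0P _ _)); rewrite modpD modpN; first by move/subr0_eq.
by move->; rewrite subrr.
Qed.

Lemma eqmodp_mul d p p' r r' :
  p %% d = p' %% d -> r %% d = r' %% d -> (p * r) %% d = (p' * r') %% d.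
Proof.
move=> eq_p eq_r; rewrite -(modp_mul p r) eq_r modp_mul mulrC.
by rewrite -(modp_mul r' p) eq_p modp_mul mulrC.
Qed.

Lemma eqmodp_mulIr c d p r :
  coprimep d c -> (p * c) %% d = (r * c) %% d -> p %% d = r %% d.
Proof.
move=> dc /eqmodpP; rewrite -mulrBl Gauss_dvdpl // => d_pr; exact/eqmodpP.
Qed.

Lemma eqmodp_dvd d d' p r : d %| d' -> p %% d' = r %% d' -> p %% d = r %% d.
Proof. by move=> dd' /eqmodpP d'pr; apply/eqmodpP/(dvdp_trans dd'). Qed.

Lemma eqmodp_mul2l c d p r :
  p %% d = r %% d -> (c * p) %% (c * d) = (c * r) %% (c * d).
Proof. by move/eqmodpP=> d_pr; apply/eqmodpP; rewrite -mulrBr dvdp_mul. Qed.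

Lemma eqmodp_sum d m n (f g : nat -> {poly F}) :
    (forall i, (m <= i < n)%N -> f i %% d = g i %% d) ->
  (\sum_(m <= i < n) f i) %% d = (\sum_(m <= i < n) g i) %% d.
Proof.
move=> fg; rewrite !(big_morph (fun p : {poly F} => p %% d) (modpD d) (mod0p d)).
exact: eq_big_nat.
Qed.

Lemma eqmodp_coef p r n i : p %% 'X^n = r %% 'X^n -> (i < n)%N -> p`_i = r`_i.
Proof.
move=> /eqmodpP /dvdpP[s def_s] lt_in; apply/eqP; rewrite -subr_eq0 -coefB def_s.
by rewrite coefMXn lt_in.
Qed.

(** * Gauss's identity modulo a power of the variable *)

(** The constant term (in q) is 1, so the product can be cancelled modulo q^m. *)
Lemma coprime_qpoch q m n : coprimep (q ^+ m) (qpoch q n).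
Proof.
apply: coprimep_expl; elim: n => [|n IHn].
  by rewrite /qpoch big_ord0 coprimep1.
rewrite /qpoch big_ord_recr /= coprimepMr IHn /=.
have -> : 1 - q ^+ n.+1 = (- q ^+ n) * q + 1 by rewrite exprS; ring.
by rewrite coprimep_addl_mul coprimep1.
Qed.

Lemma qpoch_stable q k l : (k <= l)%N ->
  qpoch q l %% q ^+ k.+1 = qpoch q k %% q ^+ k.+1.
Proof.
elim: l => [|l IHl]; first by rewrite leqn0 => /eqP->.
rewrite leq_eqVlt => /predU1P[-> //|]; rewrite ltnS => le_kl.
rewrite /qpoch big_ord_recr /= -/(qpoch q l) -[X in _ = X %% _]mulr1.
apply: eqmodp_mul (IHl le_kl) _; apply/eqmodpP.
by rewrite addrAC subrr add0r dvdpNr dvdp_exp2l.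
Qed.

(** The Gaussian binomials tend to 1 / (q; q) as both entries grow. The product
    formula shows it after multiplication by (1 - q) ... (1 - q^k), since all
    the products involved agree with this one modulo q^(k+1). *)
Lemma qbin_stable q k a b n : (k <= a)%N -> (k <= b)%N -> (k <= n)%N ->
  (qbin q (a + b) a * qpoch q n) %% q ^+ k.+1 = 1 %% q ^+ k.+1.
Proof.
move=> ka kb kn; apply: (eqmodp_mulIr (coprime_qpoch q k.+1 k)).
transitivity (qpoch q (a + b) %% q ^+ k.+1).
  rewrite -qbin_qpoch -mulrA; apply: eqmodp_mul => //.
  by apply: eqmodp_mul; rewrite !qpoch_stable.
by rewrite mul1r qpoch_stable // (leq_trans ka) // leq_addr.
Qed.

(** Partial sum of the theta series, with the terms at m and - m joined. *)
Definition theta q n := 1 + \sum_(1 <= m < n.+1) (-1) ^+ m * q ^+ (m ^ 2) *+ 2.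

(** Gauss's identity modulo q^(2n+1). The coefficients of the m-th terms of
    [finite_gauss] are 1 only modulo q^(2(n-m+1)), but the factor q^(m^2) makes
    up for it: m^2 + 2(n-m+1) = (m-1)^2 + 2n + 1. *)
Lemma theta_oddpoch q n : q != 0 ->
  theta q n %% q ^+ n.*2.+1 =
  (oddpoch q n ^+ 2 * qpoch (q ^+ 2) n) %% q ^+ n.*2.+1.
Proof.
move=> q_neq0; rewrite finite_gauss // mulrDl big_distrl /= /theta !modpD.
congr (_ + _).
  apply: (@eqmodp_dvd _ ((q ^+ 2) ^+ n.+1)).
    by rewrite -exprM; apply: dvdp_exp2l; lia.
  by rewrite -addnn qbin_stable.
apply: eqmodp_sum => m /andP[m_gt0 le_mn].
have -> : (-1) ^+ m * q ^+ (m ^ 2) *+ 2 = (-1) ^+ m * (q ^+ (m ^ 2) * (1 + 1)).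
  ring.
rewrite -!mulrA; apply: eqmodp_mul => //.
apply: (@eqmodp_dvd _ (q ^+ (m ^ 2) * (q ^+ 2) ^+ (n - m).+1)).
  by rewrite -exprM -exprD; apply: dvdp_exp2l; rewrite -mulnn; nia.
apply: eqmodp_mul2l; rewrite mulrDl !modpD.
have -> : n.*2 = (n + m + (n - m))%N by lia.
rewrite {1}qbin_stable //; [|lia..].
have -> : (n + m + (n - m) = (n - m) + (n + m))%N by lia.
by rewrite qbin_stable //; lia.
Qed.

(** * Products of theta series with the partition generating function *)

(** Agrees with the generating function of the partitions up to degree n. *)
Definition pgf n : {poly F} := \prod_(i < n) \sum_(j < n.+1) 'X^(i.+1) ^+ j.

Lemma pgf_qpoch n : (pgf n * qpoch 'X n) %% 'X^(n.+1) = 1 %% 'X^(n.+1).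
Proof.
rewrite /pgf /qpoch -big_split /=.
apply: (big_ind (fun p => p %% 'X^(n.+1) = 1 %% 'X^(n.+1))) => // [p r p1 r1|i _].
  by rewrite -[1 in RHS]mulr1; apply: eqmodp_mul.
rewrite mulrC -opprB mulNr -subrX1 opprB; apply/eqmodpP.
rewrite addrAC subrr add0r dvdpNr -exprM; apply: dvdp_exp2l; lia.
Qed.

(** By Gauss's identity theta is the square of the odd product times the even
    one; one odd factor and the even one make up (q; q), which the partition
    generating function cancels. *)
Lemma theta_pgf n :
  (theta 'X n * pgf n.*2) %% 'X^(n.*2.+1) = oddpoch 'X n %% 'X^(n.*2.+1).
Proof.
transitivity ((oddpoch 'X n * (pgf n.*2 * qpoch 'X n.*2)) %% 'X^(n.*2.+1)).
  rewrite [X in _ = X %% _](_ : _ =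
    oddpoch 'X n ^+ 2 * qpoch ('X ^+ 2) n * pgf n.*2); last first.
    by rewrite qpoch_double; ring.
  by apply: eqmodp_mul => //; rewrite theta_oddpoch // polyX_eq0.
by rewrite -[X in _ = X %% _]mulr1; apply: eqmodp_mul => //; apply: pgf_qpoch.
Qed.

(** Gauss's identity at X^2 gives oddpoch (X^2) times all the factors
    1 - X^(2k), k <= 2n, and those with k > n do not matter modulo X^(2n+1).
    Splitting oddpoch (X^2) leaves oddpoch (- X) next to a product that the
    partition generating function cancels. *)
Lemma theta2_pgf n :
  (theta ('X ^+ 2) n * pgf n.*2) %% 'X^(n.*2.+1) = oddpoch (- 'X) n %% 'X^(n.*2.+1).
Proof.
transitivity ((oddpoch (- 'X) n * (pgf n.*2 * qpoch 'X n.*2)) %% 'X^(n.*2.+1)).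
  rewrite [X in _ = X %% _](_ : _ =
    oddpoch ('X ^+ 2) n * qpoch ('X ^+ 2) n * pgf n.*2); last first.
    by rewrite qpoch_double oddpoch_sqr; ring.
  apply: eqmodp_mul => //.
  transitivity
      ((oddpoch ('X ^+ 2 : {poly F}) n * qpoch ('X ^+ 2) n.*2) %% 'X^(n.*2.+1)).
    apply: (@eqmodp_dvd _ (('X ^+ 2) ^+ n.*2.+1)).
      by rewrite -exprM; apply: dvdp_exp2l; lia.
    by rewrite theta_oddpoch ?expf_neq0 ?polyX_eq0 // qpoch_double mulrA expr2.
  apply: eqmodp_mul => //; apply: (@eqmodp_dvd _ (('X ^+ 2) ^+ n.+1)).
    by rewrite -exprM; apply: dvdp_exp2l; lia.
  by apply: qpoch_stable; lia.
by rewrite -[X in _ = X %% _]mulr1; apply: eqmodp_mul => //; apply: pgf_qpoch.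
Qed.

Lemma oddpoch_oppX n :
  oddpoch (- 'X) n = \prod_(i < n) (1 + 'X^(i.*2.+1)) :> {poly F}.
Proof.
apply: eq_bigr => i _.
by rewrite exprNn -signr_odd /= odd_double expr1 mulN1r opprK.
Qed.

Lemma comp_oddpoch q r n : oddpoch q n \Po r = oddpoch (q \Po r) n.
Proof.
rewrite /oddpoch rmorph_prod; apply: eq_bigr => i _.
by rewrite rmorphB rmorphXn rmorph1.
Qed.

Lemma coef_comp_oppX p i : (p \Po (- 'X))`_i = (-1) ^+ i * p`_i.
Proof.
elim/poly_ind: p i => [|p c IHp] i; first by rewrite comp_poly0 coef0 mulr0.
rewrite comp_polyD comp_polyM comp_polyX comp_polyC !coefD mulrN coefN.
rewrite !coefMX !coefC; case: i => [|i] /=; first by rewrite oppr0 expr0 mul1r.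
by rewrite IHp exprS; ring.
Qed.

(** The terms with a m^2 > n do not reach degree n, so the sum stops at the
    integer part of the square root of n / a. *)
Lemma coef_theta a n p : (0 < a)%N ->
  (theta 'X^a n * p)`_n =
  p`_n + (\sum_(1 <= m < (Nat.sqrt (n %/ a)).+1) (-1) ^+ m * p`_(n - a * m ^ 2)) *+ 2.
Proof.
move=> a_gt0; set k := Nat.sqrt _.
have /andP[k2 Sk2] : (a * k ^ 2 <= n < a * k.+1 ^ 2)%N.
  have [] := PeanoNat.Nat.sqrt_spec (n %/ a) (PeanoNat.Nat.le_0_l _).
  rewrite -/k => /leP le_k /ltP lt_k.
  rewrite mulnC -leq_divRL // [X in (n < X)%N]mulnC -ltn_divLR // -!mulnn.
  by rewrite le_k.
rewrite -!mulnn in k2 Sk2.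
have le_kn : (k <= n)%N by nia.
rewrite /theta mulrDl mul1r coefD big_distrl /= coef_sum; congr (_ + _).
rewrite (@big_cat_nat _ _ _ k.+1) //= [X in _ + X]big1_seq ?addr0 => [|m].
  rewrite -sumrMnl; apply: eq_big_nat => m /andP[_ lt_m].
  rewrite mulrnAl coefMn -mulrA -(rmorph_sign polyC) coefCM -exprM coefXnM.
  rewrite ltnNge (leq_trans _ k2) // -mulnn.
  by rewrite ltnS in lt_m; rewrite !leq_mul.
rewrite mem_index_iota => /andP[_ /andP[lt_km _]].
rewrite mulrnAl coefMn -mulrA -(rmorph_sign polyC) coefCM -exprM coefXnM.
by rewrite (leq_trans Sk2) ?mulr0 ?mul0rn // -mulnn !leq_mul.
Qed.
End Congruences.

(** * The two recurrences *)

Lemma partition_square_recurrence n :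
  (pn n)%:R + (\sum_(1 <= m < (Nat.sqrt n).+1)
                 (-1) ^+ m * (pn (n - m ^ 2))%:R) *+ 2 =
  (-1) ^+ n * (pn_distinct_odd n)%:R :> rat.
Proof.
have lt_n: (n < n.*2.+1)%N by lia.
have := eqmodp_coef (theta_pgf rat n) lt_n.
rewrite (coef_theta n _ (ltn0Sn 0)) divn1 /pgf pn_coef; last by lia.
under eq_bigr => m _ do (rewrite mul1n pn_coef; last by lia).
move=> ->.
have -> : oddpoch 'X n = oddpoch (- 'X) n \Po (- 'X) :> {poly rat}.
  by rewrite comp_oddpoch rmorphN /= comp_polyX opprK.
rewrite coef_comp_oppX oddpoch_oppX pn_distinct_odd_coef //; lia.
Qed.

Lemma partition_double_square_recurrence n :
  (pn n)%:R + (\sum_(1 <= m < (Nat.sqrt (n %/ 2)).+1)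
                 (-1) ^+ m * (pn (n - 2 * m ^ 2))%:R) *+ 2 =
  (pn_distinct_odd n)%:R :> rat.
Proof.
have lt_n: (n < n.*2.+1)%N by lia.
have := eqmodp_coef (theta2_pgf rat n) lt_n.
rewrite coef_theta // /pgf pn_coef; last by lia.
under eq_bigr => m _ do (rewrite pn_coef; last by lia).
move=> ->.
rewrite oddpoch_oppX pn_distinct_odd_coef //; lia.
Qed.

Theorem theorem6p5 (n : nat) (n_even : ~~ odd n) :
  \sum_(1 <= m < (Nat.sqrt n).+1) (-1) ^+ m.-1 * (pn (n - m ^ 2)%N)%:R
    = \sum_(1 <= m < (Nat.sqrt (n %/ 2)).+1)
        (-1) ^+ m.-1 * (pn (n - 2 * m ^ 2)%N)%:R :> rat
  /\
  \sum_(1 <= m < (Nat.sqrt (n %/ 2)).+1)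
        (-1) ^+ m.-1 * (pn (n - 2 * m ^ 2)%N)%:R
    = ((pn n)%:R - (pn_distinct_odd n)%:R) / 2%:R :> rat.
Proof.
have sum_shift k (f : nat -> rat) :
    \sum_(1 <= m < k) (-1) ^+ m.-1 * f m = - \sum_(1 <= m < k) (-1) ^+ m * f m.
  rewrite -sumrN; apply: eq_big_nat => -[//|m] _.
  by rewrite exprS mulN1r mulNr opprK.
(* For even n both recurrences have p_DO(n) on the right. *)
have := partition_square_recurrence n.
rewrite -signr_odd (negPf n_even) expr0 mul1r.
have := partition_double_square_recurrence n.
rewrite !(sum_shift _ (fun m => (pn (n - m ^ 2))%:R)).
rewrite !(sum_shift _ (fun m => (pn (n - 2 * m ^ 2))%:R)).
by split; lra.
Qed.
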